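(* There exists an absolute constant $C > 0$ such that the following holds. Let $m, n, k$ be positive integers satisfying $$\min\{m,n\} \geq k \geq k_0, \qquad k_0 = C \log(4mn).$$ Let $\varepsilon \in [\sqrt{k_0 / k}, 1]$ and let $r$ be a positive integer satisfying $k \geq r \geq k_0 / \varepsilon^2$. Then for every matrix $X \in \mathbb{R}^{m \times n}$ of rank $k$ there exists a matrix $Y \in \mathbb{R}^{m \times n}$ of rank $r$ such that $$\| X - Y \|_{\max} \leq \varepsilon\, \frac{k}{\sqrt{mn}} \sqrt{\mu_{\mathrm{col}}\, \mu_{\mathrm{row}}} \; \| X \|_{2},$$ where $\mu_{\mathrm{col}}$ and $\mu_{\mathrm{row}}$ are the coherences of the column space of $X$ (a subspace of $\mathbb{R}^m$) and of the row space of $X$ (a subspace of $\mathbb{R}^n$), respectively.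
   Context: $\log$ is the natural logarithm. For a real matrix $X \in \mathbb{R}^{m\times n}$, $\|X\|_{\max} = \max_{i,j} |X(i,j)|$ is the maximum norm and $\|X\|_2$ is the spectral norm (largest singular value). For a $k$-dimensional subspace $L \subseteq \mathbb{R}^m$ with orthogonal projection operator $\Pi_L : \mathbb{R}^m \to L$, the coherence of $L$ is $\mu_L = \frac{m}{k} \max_{1 \le i \le m} \|\Pi_L e_i\|^2$, where $e_1,\dots,e_m$ are the canonical basis vectors of $\mathbb{R}^m$ and $\|\cdot\|$ is the Euclidean norm; the same definition is used for subspaces of $\mathbb{R}^n$, with $n$ in place of $m$. An absolute constant is one that does not depend on any of the other quantities ($m$, $n$, $k$, $r$, $\varepsilon$, $X$). *)

(* Defs.v *)
From HB Require Import structures.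
From mathcomp Require Import all_boot all_order all_algebra.
From mathcomp Require Import all_classical all_reals all_analysis.

Set Implicit Arguments.
Unset Strict Implicit.
Unset Printing Implicit Defensive.

Import Order.TTheory GRing.Theory Num.Theory.

Local Open Scope classical_set_scope.
Local Open Scope ring_scope.

(* Following the conventions of mxalgebra, a subspace of R^m is the row space
   of a matrix with m columns and linear maps act on row vectors from the
   right. Thus the row space of X is represented by X itself and its column
   space by X^T. *)

Definition euclidean_norm {R : realType} {n : nat} (v : 'rV[R]_n) : R :=
  Num.sqrt (\sum_(j < n) v 0 j ^+ 2).

(* The rows of [kermx L^T] span the orthogonal complement of L, namely the
   vectors v such that v *m L^T = 0. *)
Definition orthogonal_projection {R : realType} {p m : nat}
    (L : 'M[R]_(p, m)) : 'M[R]_m :=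
  proj_mx <<L>>%MS (kermx L^T).

Definition coherence {R : realType} {p m : nat} (L : 'M[R]_(p, m)) : R :=
  m%:R / (\rank L)%:R *
  \big[Num.max/0]_(i < m)
     euclidean_norm (delta_mx 0 i *m orthogonal_projection L) ^+ 2.

(* When n > m this set also contains the trivial value 0, which does not
   change its maximum. *)
Definition singular_values {R : realType} {m n : nat} (X : 'M[R]_(m, n))
    : set R :=
  [set Num.sqrt a | a in [set a | eigenvalue (X^T *m X) a]].

(* The set is finite, and nonempty when n > 0, so the supremum is a maximum. *)
Definition spectral_norm {R : realType} {m n : nat} (X : 'M[R]_(m, n)) : R :=
  sup (singular_values X).

(* Main.v *)
Require Import Defs.
From mathcomp Require Import all_boot all_order all_algebra.
From mathcomp Require Import all_classical all_reals all_analysis.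
From mathcomp Require Import ring lra.

Set Implicit Arguments.
Unset Strict Implicit.
Unset Printing Implicit Defensive.

Import Order.TTheory GRing.Theory Num.Theory.

Local Open Scope ring_scope.

(** The matrix [Y] is a random sketch of [X], in the spirit of the
    Johnson-Lindenstrauss lemma. Let [P] be the orthogonal projection onto the
    column space, so that [X = P *m X], and write the entries of [X] as inner
    products [X i j = <a_i, b_j>] in [R^m], where [a_i] is the [i]-th row of
    [P] and [b_j] is the [j]-th column of [X]. By the definition of coherence
    [|a_i|^2 <= (k / m) mu_col]; and since [X] annihilates the complement of
    its row space, [|b_j|] is at most [spectral_norm X] times the norm of the
    projection of [e_j] onto the row space, which is controlled by [mu_row].
    Hence [|a_i| |b_j|] is at most the target bound without its factor [eps]
    ([coherence_row_bound]); no singular value decomposition is involved.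

    It remains to find [G] of rank at most [r] that preserves these [m * n]
    inner products up to [eps / 2] times the product of the norms; then
    [P *m G *m X] approximates [X] entrywise. A good [G] is the average of the
    outer products of [r] sign vectors [s]: for a uniform [s] the variable
    [<a, s> <b, s>] has mean [<a, b>] and a sub-exponential tail
    ([sign_mean_expR_centered]), so that [r] of order [ln (m n) / eps^2]
    suffices. Independence is replaced by choosing the vectors one after the
    other so that a sum of exponentials of the deviations grows no faster than
    on average ([greedy_sign_vectors]). This asks for only one average, over
    [{-1, 1}^d], which is a finite mean defined by recursion on [d].

    Two points remain. The spectral norm is defined through eigenvalues of
    [X^T *m X], and has to be shown to dominate [|X v| / |v|]
    ([mulmx_spectral_norm]). And the sketch has rank at most [r], while rank
    exactly [r] is wanted: the other [eps / 2] of the error, which is positive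
    as [X] is not zero, pays for a small perturbation that raises the rank
    ([exists_rank_perturbation]). *)

(** * Euclidean inner products *)

Definition dot {R : realType} {d : nat} (u v : 'rV[R]_d) : R := (u *m v^T) 0 0.

Section Dot.
Context {R : realType} {d : nat}.
Implicit Types u v w : 'rV[R]_d.

Lemma dotE u v : dot u v = \sum_j u 0 j * v 0 j.
Proof. by rewrite /dot mxE; apply: eq_bigr => j _; rewrite mxE. Qed.

Lemma dotC u v : dot u v = dot v u.
Proof. by rewrite !dotE; apply: eq_bigr => j _; rewrite mulrC. Qed.

Lemma dotDl u v w : dot (u + v) w = dot u w + dot v w.
Proof. by rewrite /dot mulmxDl mxE. Qed.

Lemma dotNl u v : dot (- u) v = - dot u v.
Proof. by rewrite /dot mulNmx mxE. Qed.

Lemma dotBl u v w : dot (u - v) w = dot u w - dot v w.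
Proof. by rewrite dotDl dotNl. Qed.

Lemma dotZl (c : R) u v : dot (c *: u) v = c * dot u v.
Proof. by rewrite /dot -scalemxAl mxE. Qed.

Lemma dotBr u v w : dot u (v - w) = dot u v - dot u w.
Proof. by rewrite dotC dotBl !(dotC u). Qed.

Lemma dotZr (c : R) u v : dot u (c *: v) = c * dot u v.
Proof. by rewrite dotC dotZl dotC. Qed.

Lemma dot_ge0 u : 0 <= dot u u.
Proof. by rewrite dotE sumr_ge0 // => j _; rewrite -expr2 sqr_ge0. Qed.

Lemma dot_eq0 u : (dot u u == 0) = (u == 0).
Proof.
apply/eqP/eqP => [|->]; last by rewrite /dot mul0mx mxE.
rewrite dotE => /eqP; rewrite psumr_eq0 => [/allP h|j _]; last first.
  by rewrite -expr2 sqr_ge0.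
apply/rowP => j; rewrite mxE; have := h j (mem_index_enum _).
by rewrite -expr2 sqrf_eq0 => /eqP.
Qed.

Lemma euclidean_norm_sqr u : euclidean_norm u ^+ 2 = dot u u.
Proof.
rewrite /euclidean_norm sqr_sqrtr; last by apply: sumr_ge0 => j _; exact: sqr_ge0.
by rewrite dotE; apply: eq_bigr => j _; rewrite expr2.
Qed.

Lemma euclidean_norm_ge0 u : 0 <= euclidean_norm u.
Proof. exact: sqrtr_ge0. Qed.

Lemma euclidean_norm0 : euclidean_norm (0 : 'rV[R]_d) = 0.
Proof.
by rewrite /euclidean_norm big1 ?sqrtr0 // => j _; rewrite mxE expr0n.
Qed.

Lemma dot_mulmx p u (A : 'M[R]_(d, p)) (v : 'rV_p) :
  dot (u *m A) v = dot u (v *m A^T).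
Proof. by rewrite /dot trmx_mul trmxK mulmxA. Qed.

(** The discriminant argument: [w Q w^T >= 0] on a suitable combination [w] of
    [u] and [v]. When [v] is isotropic, the coefficients [1] and [t] for large
    [t] force [u Q v^T = 0]. *)
Lemma psd_Cauchy_Schwarz (Q : 'M[R]_d) u v :
  Q^T = Q -> (forall w, 0 <= dot (w *m Q) w) ->
  dot (u *m Q) v ^+ 2 <= dot (u *m Q) u * dot (v *m Q) v.
Proof.
move=> Qsym Qpos.
have Qvu : dot (v *m Q) u = dot (u *m Q) v by rewrite dot_mulmx Qsym dotC.
have Qcomb s t : 0 <= s ^+ 2 * dot (u *m Q) u - 2 * s * t * dot (u *m Q) v
                     + t ^+ 2 * dot (v *m Q) v.
  have := Qpos (s *: u - t *: v).
  rewrite mulmxBl -!scalemxAl dotBl !dotBr !dotZl !dotZr Qvu.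
  by congr (0 <= _); ring.
set A := dot _ u in Qcomb *; set B := dot _ v in Qcomb *.
set C := dot _ v in Qcomb *.
have A0 : 0 <= A by apply: Qpos.
have : 0 <= C by apply: Qpos.
rewrite le_eqVlt => /predU1P[C0|Cgt0].
  (* this combination has the value [A - (A + 1) = -1] *)
  have [-> |B0] := eqVneq B 0; first by rewrite -C0 expr0n mulr0.
  have := Qcomb 1 ((A + 1) / (2 * B)).
  rewrite -C0 (_ : _ + _ = - 1) ?lerN10 //; first by lra.
  by field.
rewrite -subr_ge0 -(pmulr_rge0 _ Cgt0).
by have := Qcomb C B; congr (0 <= _); ring.
Qed.

Lemma Cauchy_Schwarz u v : dot u v ^+ 2 <= dot u u * dot v v.
Proof.
have := @psd_Cauchy_Schwarz 1%:M u v; rewrite !mulmx1; apply.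
  exact: trmx1.
by move=> w; rewrite mulmx1 dot_ge0.
Qed.

End Dot.

Lemma dot_row_mx {R : realType} {d : nat} (a b : 'rV[R]_1) (u v : 'rV[R]_d) :
  dot (row_mx a u) (row_mx b v) = a 0 0 * b 0 0 + dot u v.
Proof.
by rewrite {1}/dot tr_row_mx mul_row_col mxE {1}mxE big_ord1 mxE.
Qed.

Lemma row_mx_surj (T : Type) (d : nat) (a : 'rV[T]_d.+1) :
  exists (t : 'rV_1) (u : 'rV_d), a = row_mx t u.
Proof.
by exists (@lsubmx _ _ 1 d a), (@rsubmx _ _ 1 d a); rewrite hsubmxK.
Qed.

(** * Averages over sign vectors *)

(** The mean of [F] over [{-1, 1}^d], one coordinate at a time: this shape
    makes linearity, the second moments and the exponential estimate below
    inductions on the dimension. *)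
Fixpoint sign_mean {R : realType} (d : nat) : ('rV[R]_d -> R) -> R :=
  match d with
  | 0 => fun F => F 0
  | d'.+1 => fun F =>
      (sign_mean (fun s : 'rV_d' => F (row_mx (1 : 'rV_1) s : 'rV_(1 + d'))) +
       sign_mean (fun s : 'rV_d' => F (row_mx (- 1 : 'rV_1) s : 'rV_(1 + d'))))
      / 2
  end.

Section SignMean.
Context {R : realType}.

Lemma eq_sign_mean d (F G : 'rV[R]_d -> R) :
  (forall s, F s = G s) -> sign_mean F = sign_mean G.
Proof.
elim: d F G => [|d IH] F G eqFG /=; first exact: eqFG.
by congr ((_ + _) / 2); apply: IH => s.
Qed.

Lemma sign_mean_le d (F G : 'rV[R]_d -> R) :
  (forall s, F s <= G s) -> sign_mean F <= sign_mean G.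
Proof.
elim: d F G => [|d IH] F G leFG /=; first exact: leFG.
by rewrite ler_wpM2r ?invr_ge0 // lerD // IH.
Qed.

Lemma sign_meanD d (F G : 'rV[R]_d -> R) :
  sign_mean (fun s => F s + G s) = sign_mean F + sign_mean G.
Proof. by elim: d F G => [|d IH] F G //=; rewrite !IH; ring. Qed.

Lemma sign_meanZ d (c : R) (F : 'rV[R]_d -> R) :
  sign_mean (fun s => c * F s) = c * sign_mean F.
Proof. by elim: d F => [|d IH] F //=; rewrite !IH; ring. Qed.

Lemma sign_mean_cst d (c : R) : sign_mean (fun _ : 'rV[R]_d => c) = c.
Proof. by elim: d => [|d IH] //=; rewrite !IH; field. Qed.

Lemma sign_mean_sum d (I : Type) (r : seq I) (F : I -> 'rV[R]_d -> R) :
  sign_mean (fun s => \sum_(i <- r) F i s) = \sum_(i <- r) sign_mean (F i).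
Proof.
elim: r => [|i r IH].
  by rewrite big_nil -[RHS](@sign_mean_cst d); apply: eq_sign_mean => s; rewrite big_nil.
rewrite big_cons -IH -sign_meanD.
by apply: eq_sign_mean => s; rewrite big_cons.
Qed.

Lemma exists_le_sign_mean d (F : 'rV[R]_d -> R) : exists s, F s <= sign_mean F.
Proof.
elim: d F => [|d IH] F /=; first by exists 0.
set M1 := sign_mean _; set M2 := sign_mean _.
have [le12|/ltW le21] := leP M1 M2.
  have [s Fs] := IH (fun s => F (row_mx (1 : 'rV_1) s : 'rV_(1 + d))).
  by exists (row_mx (1 : 'rV_1) s); rewrite ler_pdivlMr //; move: Fs; rewrite -/M1; lra.
have [s Fs] := IH (fun s => F (row_mx (- 1 : 'rV_1) s : 'rV_(1 + d))).
by exists (row_mx (- 1 : 'rV_1) s); rewrite ler_pdivlMr //; move: Fs; rewrite -/M2; lra.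
Qed.

Lemma sign_mean_dotM d (a b : 'rV[R]_d) :
  sign_mean (fun s => dot a s * dot b s) = dot a b.
Proof.
elim: d a b => [|d IH] a b /=.
  by rewrite !dotE !big_ord0 mulr0.
have [a0 [a' ->]] := row_mx_surj a; have [b0 [b' ->]] := row_mx_surj b.
rewrite -sign_meanD dot_row_mx.
rewrite (@eq_sign_mean _ _ (fun s => 2 * (a0 0 0 * b0 0 0) + 2 * (dot a' s * dot b' s))).
  by rewrite sign_meanD sign_mean_cst sign_meanZ IH; field.
by move=> s; rewrite !dot_row_mx !mxE /=; ring.
Qed.

(** * Exponential moments *)

Lemma expR_le_1_minus_inv (x : R) : x < 1 -> expR x <= (1 - x)^-1.
Proof.
move=> x1; rewrite -[expR x]invrK -expRN lef_pV2 ?posrE ?expR_gt0 ?subr_gt0 //.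
exact: expR_ge1Dx.
Qed.

(** For small [x] both exponentials are at most [1 / (1 -+ x)], whose mean is
    [1 / (1 - x^2)]; for large [x] already [`|x| <= 2 x^2]. *)
Lemma cosh_le (x : R) : (expR x + expR (- x)) / 2 <= expR (2 * x ^+ 2).
Proof.
have [small|large] := leP (`|x|) 2^-1.
  have [lo hi] : - 2^-1 <= x /\ x <= 2^-1 by apply/andP; rewrite -ler_norml.
  have h1 : expR x <= (1 - x)^-1 by apply: expR_le_1_minus_inv; lra.
  have h2 : expR (- x) <= (1 - - x)^-1 by apply: expR_le_1_minus_inv; lra.
  have x2 : x ^+ 2 <= 2^-1 by nra.
  apply: (@le_trans _ _ (1 - x ^+ 2)^-1).
    have -> : (1 - x ^+ 2)^-1 = ((1 - x)^-1 + (1 - - x)^-1) / 2.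
      by field; rewrite !gt_eqF //; nra.
    by rewrite ler_wpM2r ?invr_ge0 // lerD.
  rewrite invf_ple ?posrE ?expR_gt0 //; last by lra.
  rewrite -[_^-1]mulr1 ler_pdivrMl ?expR_gt0 //.
  have := expR_ge1Dx (2 * x ^+ 2).
  have := sqr_ge0 x.
  by nra.
have : `|x| <= 2 * x ^+ 2 by rewrite -real_normK ?num_real //; nra.
move=> h; rewrite ler_pdivrMr // mulr_natr mulr2n lerD // ler_expR;
  apply: le_trans h; [exact: ler_norm | by rewrite -normrN ler_norm].
Qed.

(** Integrating out one sign turns [c] into [c (1 + 8 c t^2)], where [t] is
    the coefficient of that sign; since [1 / c] thereby decreases by at most
    [8 t^2], the condition on [c] survives in the remaining dimension. *)
Lemma sign_mean_expR_sqr d (a : 'rV[R]_d) (c : R) :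
  0 <= c -> c * (8 + 8 * dot a a) <= 1 ->
  sign_mean (fun s => expR (c * dot a s ^+ 2)) <= expR (dot a a / 8).
Proof.
elim: d a c => [|d IH] a c c0 hc /=.
  by rewrite !dotE !big_ord0 expr0n /= mulr0 mul0r.
have [a0 [a' eq_a]] := row_mx_surj a; move: hc; rewrite {}eq_a dot_row_mx.
set t := a0 0 0 => hc.
have a'0 := dot_ge0 a'.
pose c' := c * (1 + 8 * c * t ^+ 2).
have t20 := sqr_ge0 t.
have c'0 : 0 <= c' by rewrite mulr_ge0 // addr_ge0 // mulr_ge0 // mulr_ge0.
have hc' : c' * (8 + 8 * dot a' a') <= 1.
  rewrite /c'; set q := 8 * c * t ^+ 2.
  have hq : c * (8 + 8 * dot a' a') <= 1 - q by rewrite /q; nra.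
  have q0 : 0 <= q by rewrite /q mulr_ge0 // mulr_ge0.
  by nra.
apply: (@le_trans _ _ (sign_mean (fun s => expR (c * t ^+ 2) * expR (c' * dot a' s ^+ 2)))).
  rewrite -sign_meanD mulrC -sign_meanZ; apply: sign_mean_le => s.
  rewrite !dot_row_mx !mxE /= -/t mulr1 mulrN1; set y := dot a' s.
  have -> : expR (c * (t + y) ^+ 2) =
      expR (c * t ^+ 2 + c * y ^+ 2) * expR (2 * c * t * y).
    by rewrite -expRD; congr expR; ring.
  have -> : expR (c * (- t + y) ^+ 2) =
      expR (c * t ^+ 2 + c * y ^+ 2) * expR (- (2 * c * t * y)).
    by rewrite -expRD; congr expR; ring.
  rewrite -mulrDr mulrCA (mulrC 2^-1).
  rewrite (_ : _ * expR (c' * _) = expR (c * t ^+ 2 + c * y ^+ 2)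
     * expR (2 * (2 * c * t * y) ^+ 2)); last first.
    by rewrite -!expRD /c'; congr expR; ring.
  by rewrite ler_wpM2l ?expR_ge0 // cosh_le.
rewrite sign_meanZ mulrDl expRD ler_pM ?expR_ge0 //.
- rewrite -[0](@sign_mean_cst d); apply: sign_mean_le => s; exact: expR_ge0.
- by rewrite ler_expR -expr2; nra.
- exact: IH.
Qed.

Lemma expR_le_quadratic (x : R) : expR x <= 1 + x + x ^+ 2 * expR `|x|.
Proof.
have h1 : expR x - 1 <= x * expR x.
  have := expR_ge1Dx (- x); rewrite expRN => h.
  have := ler_wpM2r (expR_ge0 x) h; rewrite mulVf ?gt_eqF ?expR_gt0 //; lra.
have h2 := expR_ge1Dx x.
have [x0|/ltW x0] := leP 0 x.
  by rewrite ger0_norm //; nra.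
have : 1 <= expR `|x| by rewrite -expR0 ler_expR.
by have := sqr_ge0 x; nra.
Qed.

(** A constant such that [dot a s * dot b s - dot a b] has a Laplace transform
    below that of a Gaussian of variance [2 * proxy] near the origin: [48 ^+ 2]
    comes from bounding [z ^+ 2] by [48 ^+ 2 * expR (z / 24)], and [expR 1]
    covers the exponential moments of order [1 / 16]. *)
Definition proxy : R := 48 ^+ 2 * expR 1.

(** A second-order expansion of the exponential: the linear term averages to
    zero, and the quadratic remainder is dominated by exponentials of
    [dot a s ^+ 2 / 16] and [dot b s ^+ 2 / 16]. *)
Lemma sign_mean_expR_centered d (a b : 'rV[R]_d) (x : R) :
  dot a a <= 1 -> dot b b <= 1 -> `|x| <= 48^-1 ->
  sign_mean (fun s => expR (x * (dot a s * dot b s - dot a b)))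
    <= expR (proxy * x ^+ 2).
Proof.
move=> a1 b1 hx.
pose Z s := dot a s * dot b s - dot a b.
pose W s := expR (16^-1 * dot a s ^+ 2) + expR (16^-1 * dot b s ^+ 2).
pose K := 48 ^+ 2 * expR 16^-1 / 2 : R.
have ab1 : `|dot a b| <= 1.
  have := Cauchy_Schwarz a b; have := dot_ge0 a; have := dot_ge0 b.
  by rewrite ler_norml; move=> *; apply/andP; split; nra.
have Z_le s : `|Z s| <= (dot a s ^+ 2 + dot b s ^+ 2) / 2 + 1.
  apply: le_trans (ler_normB _ _) _; rewrite lerD // normrM.
  rewrite -(real_normK (num_real (dot a s))) -(real_normK (num_real (dot b s))).
  by have := sqr_ge0 (`|dot a s| - `|dot b s|); nra.
have remainder s : (x * Z s) ^+ 2 * expR `|x * Z s| <= x ^+ 2 * (K * W s).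
  rewrite exprMn -mulrA ler_wpM2l ?sqr_ge0 //.
  have Z0 := normr_ge0 (Z s).
  have -> : Z s ^+ 2 = 48 ^+ 2 * (`|Z s| / 48) ^+ 2.
    by rewrite expr_div_n real_normK ?num_real //; field.
  (* [1 / 16] is split in three: [2 / 48] for the square, [1 / 48] for [x] *)
  have sq_le : (`|Z s| / 48) ^+ 2 <= expR (2 * (`|Z s| / 48)).
    rewrite mulr_natl mulr2n expRD -expr2 ler_sqr ?nnegrE ?expR_ge0 ?divr_ge0 //.
    by have := expR_ge1Dx (`|Z s| / 48); lra.
  have lin_le : expR `|x * Z s| <= expR (`|Z s| / 48).
    by rewrite ler_expR normrM mulrC ler_wpM2l.
  have prod_le : (`|Z s| / 48) ^+ 2 * expR `|x * Z s| <=
      expR 16^-1 * (W s / 2).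
    apply: (@le_trans _ _ (expR (2 * (`|Z s| / 48)) * expR (`|Z s| / 48))).
      by rewrite ler_pM ?sqr_ge0 ?expR_ge0.
    pose p := expR (32^-1 * dot a s ^+ 2); pose q := expR (32^-1 * dot b s ^+ 2).
    have -> : W s = p ^+ 2 + q ^+ 2.
      by rewrite /W /p /q -!expRM_natl; congr (expR _ + expR _); field.
    apply: (@le_trans _ _ (expR 16^-1 * (p * q))).
      by rewrite -!expRD ler_expR; have := Z_le s; lra.
    by rewrite ler_wpM2l ?expR_ge0 //; have := sqr_ge0 (p - q); nra.
  rewrite -mulrA (_ : K * W s = 48 ^+ 2 * (expR 16^-1 * (W s / 2))).
    by rewrite ler_wpM2l ?sqr_ge0.
  by rewrite /K; field.
have W_mean (c : 'rV[R]_d) : dot c c <= 1 ->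
    sign_mean (fun s => expR (16^-1 * dot c s ^+ 2)) <= expR 8^-1.
  move=> c1; apply: (@le_trans _ _ (expR (dot c c / 8))).
    by apply: sign_mean_expR_sqr; lra.
  by rewrite ler_expR; lra.
have Z_mean : sign_mean Z = 0.
  rewrite (@eq_sign_mean _ _ (fun s => dot a s * dot b s + - dot a b)) //.
  by rewrite sign_meanD sign_mean_dotM sign_mean_cst subrr.
apply: (@le_trans _ _ (sign_mean (fun s => 1 + x * Z s + x ^+ 2 * (K * W s)))).
  apply: sign_mean_le => s; apply: le_trans (expR_le_quadratic _) _.
  by rewrite lerD2l; exact: remainder.
rewrite !sign_meanD !sign_meanZ sign_mean_cst Z_mean mulr0 addr0 sign_meanD.
apply: le_trans (expR_ge1Dx _); rewrite lerD2l mulrC ler_wpM2r ?sqr_ge0 //.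
have sum_le := lerD (W_mean a a1) (W_mean b b1).
apply: (@le_trans _ _ (K * (expR 8^-1 + expR 8^-1))).
  by rewrite ler_wpM2l // /K divr_ge0 // mulr_ge0 ?expR_ge0.
rewrite (_ : K * _ = 48 ^+ 2 * (expR 16^-1 * expR 8^-1)); last by rewrite /K; field.
by rewrite -expRD /proxy ler_wpM2l // ler_expR; lra.
Qed.
End SignMean.
(** * Greedy choice of the sign vectors *)

Section Sketch.
Context {R : realType}.

(** The sum of exponentials is a pessimistic estimator for all deviations at
    once: by the exponential moment bound, averaging over one more sign vector
    multiplies it by at most [expR (proxy * x ^+ 2)], so some sign vector does
    no worse. *)
Lemma greedy_sign_vectors (I : finType) (d : nat) (a b : I -> 'rV[R]_d) (x : R)
    (r : nat) :
  (forall i, dot (a i) (a i) <= 1) -> (forall i, dot (b i) (b i) <= 1) ->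
  `|x| <= 48^-1 ->
  exists2 H : 'M[R]_d, (\rank H <= r)%N &
    let D i := dot (a i *m H) (b i) - r%:R * dot (a i) (b i) in
    \sum_i (expR (x * D i) + expR (- x * D i))
      <= 2 * #|I|%:R * expR (proxy * x ^+ 2 *+ r).
Proof.
move=> a1 b1 hx; elim: r => [|r [H rkH IH]].
  exists 0; rewrite ?mxrank0 //= mulr0n expR0 mulr1.
  rewrite (eq_bigr (fun=> 2)) => [|i _]; last first.
    by rewrite mulmx0 /dot mul0mx mxE mul0r subr0 !mulr0 expR0.
  by rewrite sumr_const mulr_natr.
set D := fun i => _ in IH.
pose Z i s := dot (a i) s * dot (b i) s - dot (a i) (b i).
pose F s := \sum_i (expR (x * D i) * expR (x * Z i s) +
                    expR (- x * D i) * expR (- x * Z i s)).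
have [s Fs] := exists_le_sign_mean F.
exists (H + s^T *m s).
  apply: leq_trans (mxrank_add _ _) _; rewrite -(addn1 r) leq_add //.
  exact: leq_trans (mxrankM_maxr _ _) (rank_leq_row _).
have -> /= : (fun i => dot (a i *m (H + s^T *m s)) (b i)
              - r.+1%:R * dot (a i) (b i)) = fun i => D i + Z i s.
  apply/funext => i; rewrite /D /Z mulmxDr dotDl mulmxA.
  have -> : dot (a i *m s^T *m s) (b i) = dot (a i) s * dot (b i) s.
    by rewrite dot_mulmx (dotC (b i)) dotE big_ord1 -[_ 0 0]/(dot _ _)
               -[(b i *m s^T) 0 0]/(dot _ _) (dotC s).
  by rewrite -natr1; ring.
rewrite (_ : \sum_i _ = F s); last first.
  by apply: eq_bigr => i _; rewrite !mulrDr !expRD.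
apply: le_trans Fs _.
rewrite [_ *+ r.+1]mulrSr expRD mulrA; apply: le_trans (ler_wpM2r (expR_ge0 _) IH).
rewrite /F sign_mean_sum mulr_suml ler_sum // => i _.
rewrite sign_meanD !sign_meanZ mulrDl lerD // ler_wpM2l ?expR_ge0 //.
  exact: sign_mean_expR_centered.
by rewrite -(sqrrN x); apply: sign_mean_expR_centered; rewrite ?normrN.
Qed.

(** The deviation of a sum of [r] outer products from [r] times the identity
    is at most [ln (2 #|I|) / x + proxy * x * r]; the choice
    [x = eps / (2 * proxy)] makes each term at most [eps * r / 2]. *)
Lemma exists_sketch_unit (I : finType) (d : nat) (a b : I -> 'rV[R]_d)
    (eps : R) (r : nat) :
  (forall i, dot (a i) (a i) <= 1) -> (forall i, dot (b i) (b i) <= 1) ->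
  0 < eps -> eps <= 1 -> (0 < r)%N ->
  4 * proxy * ln (2 * #|I|%:R) <= r%:R * eps ^+ 2 ->
  exists2 G : 'M[R]_d, (\rank G <= r)%N &
    forall i, `|dot (a i) (b i) - dot (a i *m G) (b i)| <= eps.
Proof.
move=> a1 b1 e0 e1 r0 hr.
have rR0 : (0 : R) < r%:R by rewrite ltr0n.
have e_ge1 : 1 <= expR 1 :> R by rewrite -expR0 ler_expR.
have K_ge : 24 <= proxy :> R by rewrite /proxy; lra.
have K0 : 0 < proxy :> R by lra.
pose x : R := eps / (2 * proxy).
have x0 : 0 < x by rewrite divr_gt0 // mulr_gt0.
have hx : `|x| <= 48^-1.
  rewrite gtr0_norm // ler_pdivrMr ?mulr_gt0 //; lra.
have [H rkH] := @greedy_sign_vectors I d a b x r a1 b1 hx.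
set D := fun i => _; move=> /= sumH.
exists (r%:R^-1 *: H) => [|i]; first exact: leq_trans (mxrank_scale _ _) rkH.
have I0 : (0 : R) < #|I|%:R by rewrite ltr0n; apply/card_gt0P; exists i.
pose L := ln (2 * #|I|%:R) + proxy * x ^+ 2 * r%:R.
have LE : expR L = 2 * #|I|%:R * expR (proxy * x ^+ 2 *+ r).
  by rewrite /L expRD lnK ?posrE ?mulr_gt0 // (mulr_natr (proxy * _)).
have term : expR (x * D i) + expR (- x * D i) <= expR L.
  by rewrite LE; apply: le_trans sumH; rewrite (bigD1 i) //= lerDl sumr_ge0.
have D_le : x * `|D i| <= L.
  rewrite -(gtr0_norm x0) -normrM ler_norml; apply/andP; split.
    rewrite lerNl -ler_expR -mulNr; apply: le_trans term; rewrite lerDr expR_ge0 //.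
  by rewrite -ler_expR; apply: le_trans term; rewrite lerDl expR_ge0.
have -> : dot (a i) (b i) - dot (a i *m (r%:R^-1 *: H)) (b i) = - (D i / r%:R).
  rewrite -scalemxAr dotZl /D; field; exact: lt0r_neq0.
rewrite normrN normrM normfV (gtr0_norm rR0) ler_pdivrMr //.
have L_le : L <= x * (eps * r%:R).
  have -> : x * (eps * r%:R) = r%:R * eps ^+ 2 / (4 * proxy) + proxy * x ^+ 2 * r%:R.
    by rewrite /x; field; rewrite gt_eqF.
  rewrite lerD2r ler_pdivlMr ?mulr_gt0 //; lra.
by rewrite -(ler_pM2l x0); apply: le_trans D_le L_le.
Qed.

(** The error scales with the norms; a zero vector normalises to itself, as
    [0^-1 = 0]. *)
Lemma exists_sketch (I : finType) (d : nat) (a b : I -> 'rV[R]_d)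
    (eps : R) (r : nat) :
  0 < eps -> eps <= 1 -> (0 < r)%N ->
  4 * proxy * ln (2 * #|I|%:R) <= r%:R * eps ^+ 2 ->
  exists2 G : 'M[R]_d, (\rank G <= r)%N &
    forall i, `|dot (a i) (b i) - dot (a i *m G) (b i)|
                <= eps * (euclidean_norm (a i) * euclidean_norm (b i)).
Proof.
move=> e0 e1 r0 hr.
pose unit (u : 'rV[R]_d) := (euclidean_norm u)^-1 *: u.
have unit_le1 u : dot (unit u) (unit u) <= 1.
  rewrite /unit dotZl dotZr mulrA -invfM -expr2 mulrC -euclidean_norm_sqr.
  have [->|u0] := eqVneq (euclidean_norm u) 0; first by rewrite expr0n /= mul0r ler01.
  by rewrite divff // expf_neq0.
have unitK u : u = euclidean_norm u *: unit u.
  rewrite /unit scalerA; have [u0|u0] := eqVneq (euclidean_norm u) 0.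
    rewrite u0 mul0r scale0r; apply/eqP.
    by rewrite -dot_eq0 -euclidean_norm_sqr u0 expr0n.
  by rewrite divff // scale1r.
have [G rkG hG] := @exists_sketch_unit I d (unit \o a) (unit \o b) eps r
  (fun i => unit_le1 _) (fun i => unit_le1 _) e0 e1 r0 hr.
exists G => // i.
move: (hG i) (unitK (a i)) (unitK (b i)) => /=.
move: (unit (a i)) (unit (b i)) => u v.
move: (euclidean_norm_ge0 (a i)) (euclidean_norm_ge0 (b i)).
move: (euclidean_norm (a i)) (euclidean_norm (b i)) => s t s0 t0 huv -> ->.
rewrite -scalemxAl !dotZl !dotZr.
rewrite (_ : _ - _ = (dot u v - dot (u *m G) v) * (s * t)); last by ring.
by rewrite normrM (ger0_norm (mulr_ge0 s0 t0)) ler_wpM2r ?mulr_ge0.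
Qed.

End Sketch.
(** * Orthogonal projections *)

Section Projection.
Context {R : realType} {p m : nat} (L : 'M[R]_(p, m)).

(** Over the reals a vector orthogonal to itself is zero; with the dimension
    count below, this makes [proj_mx] a projection along a true complement. *)
Lemma capmx_orthogonal : (<<L>> :&: kermx L^T)%MS = 0.
Proof.
apply/eqP/rowV0P => v; rewrite sub_capmx genmxE => /andP[/submxP[c ->]].
move/sub_kermxP => h; apply/eqP.
by rewrite -dot_eq0 dot_mulmx h /dot trmx0 mulmx0 mxE.
Qed.

Lemma addmx_orthogonal : row_full (<<L>> + kermx L^T)%MS.
Proof.
have := mxrank_sum_cap <<L>>%MS (kermx L^T).
rewrite capmx_orthogonal mxrank0 addn0 mxrank_ker mxrank_tr genmxE.
by rewrite subnKC ?rank_leq_col // => /eqP.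
Qed.

Lemma mulmx_orthogonal_projection_tr :
  orthogonal_projection L *m L^T = L^T.
Proof.
have /(@proj_mx_compl_sub _ _ _ _ _ 1%:M) : (1%:M <= <<L>> + kermx L^T)%MS.
  by rewrite sub1mx addmx_orthogonal.
by rewrite mul1mx => /sub_kermxP /eqP; rewrite mulmxBl mul1mx subr_eq0 => /eqP.
Qed.

Lemma orthogonal_projection_coherence i : (0 < \rank L)%N ->
  euclidean_norm (row i (orthogonal_projection L)) ^+ 2
    <= (\rank L)%:R / m%:R * coherence L.
Proof.
move=> rk0.
have m0 : (0 < m)%N by apply: leq_trans rk0 (rank_leq_col L).
rewrite /coherence mulrA mulf_div [X in X / _]mulrC divff ?mul1r; last first.
  by rewrite mulf_neq0 // pnatr_eq0 -lt0n.
rewrite rowE; exact: (le_bigmax _ (fun i => euclidean_norm _ ^+ 2)).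
Qed.

End Projection.

(** * The spectral norm bounds the Rayleigh quotient *)

Section Spectral.
Context {R : realType}.

Lemma dot_mulmx_bounded (n : nat) (A : 'M[R]_n) :
  exists2 M : R, 0 < M & forall v, dot (v *m A) v <= M * dot v v.
Proof.
pose M : R := 1 + \sum_i \sum_j `|A i j|.
have M0 : 0 < M by rewrite ltr_pwDl // sumr_ge0 // => i _; rewrite sumr_ge0.
exists M => // v.
have coord_le i : v 0 i ^+ 2 <= dot v v.
  rewrite dotE (bigD1 i) //= -expr2 lerDl sumr_ge0 // => j _.
  by rewrite -expr2 sqr_ge0.
apply: (@le_trans _ _ (\sum_i \sum_j `|A i j| * dot v v)); last first.
  under eq_bigr do rewrite -mulr_suml.
  by rewrite -mulr_suml ler_wpM2r ?dot_ge0 // lerDr.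
rewrite dotE; under eq_bigr do rewrite mxE mulr_suml.
rewrite exchange_big /= ler_sum // => i _; rewrite ler_sum // => j _.
have := coord_le i; have := coord_le j.
have := ler_norm (A i j * (v 0 i * v 0 j)); rewrite normrM => h hj hi.
have hv : `|v 0 i * v 0 j| <= dot v v.
  rewrite ler_norml; apply/andP; split.
    by have := sqr_ge0 (v 0 i + v 0 j); lra.
  by have := sqr_ge0 (v 0 i - v 0 j); lra.
have -> : v 0 i * A i j * v 0 j = A i j * (v 0 i * v 0 j) by ring.
apply: (le_trans h).
by rewrite ler_wpM2l.
Qed.

(** If [Q] is invertible, [v = (v *m invmx Q) *m Q] and Cauchy-Schwarz for the
    form of [Q] give [|v|^4 <= (v Q v^T) (v Q^-1 v^T)], while the last factor
    is [O(|v|^2)]. *)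
Lemma psd_unit_definite (n : nat) (Q : 'M[R]_n) :
  Q^T = Q -> (forall w, 0 <= dot (w *m Q) w) -> Q \in unitmx ->
  exists2 c : R, 0 < c & forall v, c * dot v v <= dot (v *m Q) v.
Proof.
move=> Qsym Qpos Qunit.
have [M M0 hM] := dot_mulmx_bounded (invmx Q).
exists M^-1 => [|v]; first by rewrite invr_gt0.
have := psd_Cauchy_Schwarz (v *m invmx Q) v Qsym Qpos.
rewrite mulmxKV // (dotC v) => h.
rewrite mulrC ler_pdivrMr //.
have := dot_ge0 v; rewrite le_eqVlt => /predU1P[<-|v0].
  by rewrite mulr_ge0 // ltW.
rewrite -(ler_pM2l v0) -expr2; apply: (le_trans h).
by rewrite mulrA (mulrC _ M) mulrA ler_wpM2r.
Qed.

(** The least [c] with [v A v^T <= c |v|^2] for all [v] is an eigenvalue: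
    otherwise [c - A] would be invertible and positive semidefinite, hence
    definite, and [c] could be decreased. *)
Lemma exists_eigenvalue_ge_Rayleigh (n : nat) (A : 'M[R]_n) :
  (0 < n)%N -> A^T = A ->
  exists2 c : R, eigenvalue A c & forall v, dot (v *m A) v <= c * dot v v.
Proof.
move=> n0 Asym.
pose S : set R := [set c | forall v, dot (v *m A) v <= c * dot v v]%classic.
have [M M0 hM] := dot_mulmx_bounded A.
pose e : 'rV[R]_n := delta_mx 0 (Ordinal n0).
have e1 : dot e e = 1 by rewrite /dot trmx_delta mul_delta_mx mxE !eqxx.
have Slb : lbound S (dot (e *m A) e).
  by move=> c /(_ e); rewrite e1 mulr1.
have SM : S M by exact: hM.
pose c := inf S.
have cS v : dot (v *m A) v <= c * dot v v.
  have := dot_ge0 v; rewrite le_eqVlt => /predU1P[v0|v0].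
    have /eqP : dot v v == 0 by rewrite -v0.
    by move/eqP; rewrite dot_eq0 => /eqP ->; rewrite mul0mx /dot mul0mx mxE mulr0.
  rewrite -ler_pdivrMr //; apply: lb_le_inf; first by exists M.
  by move=> c' /(_ v); rewrite -ler_pdivrMr.
exists c => //; apply: contraT => not_eigen.
pose Q := c%:M - A.
have dotQ v : dot (v *m Q) v = c * dot v v - dot (v *m A) v.
  by rewrite mulmxBr mul_mx_scalar dotBl dotZl.
have Qsym : Q^T = Q by rewrite linearB /= tr_scalar_mx Asym.
have Qpos w : 0 <= dot (w *m Q) w by rewrite dotQ subr_ge0.
have Qunit : Q \in unitmx.
  rewrite -row_free_unit -kermx_eq0; apply/negPn/negP => /rowV0Pn[v].
  move=> /sub_kermxP; rewrite mulmxBr mul_mx_scalar => /eqP; rewrite subr_eq0.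
  move=> /eqP eq_v v0; move/negP: not_eigen; apply.
  by apply/eigenvalueP; exists v.
have [t t0 ht] := psd_unit_definite Qsym Qpos Qunit.
have : c <= c - t.
  apply: ge_inf; first by exists (dot (e *m A) e).
  by move=> v; have := ht v; rewrite dotQ; lra.
lra.
Qed.

Lemma dot_gram (m n : nat) (X : 'M[R]_(m, n)) (v : 'rV_n) :
  dot (v *m (X^T *m X)) v = dot (v *m X^T) (v *m X^T).
Proof. by rewrite mulmxA dot_mulmx. Qed.

(** The Rayleigh bound for the Gram matrix [X^T *m X], whose eigenvalues are
    nonnegative, so that the square root of the largest is the supremum. *)
Lemma mulmx_spectral_norm (m n : nat) (X : 'M[R]_(m, n)) (v : 'rV_n) :
  euclidean_norm (v *m X^T) <= spectral_norm X * euclidean_norm v.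
Proof.
case: (posnP n) => [n0|n0].
  have -> : v = 0 by move: v; rewrite n0 => v; exact: thinmx0.
  by rewrite mul0mx !euclidean_norm0 mulr0.
have gram_sym : (X^T *m X)^T = X^T *m X by rewrite trmx_mul trmxK.
have [c ceig hc] := exists_eigenvalue_ge_Rayleigh n0 gram_sym.
have eig_le a : eigenvalue (X^T *m X) a -> 0 <= a <= c.
  case/eigenvalueP => w hw w0.
  have ww : 0 < dot w w by rewrite lt_def dot_ge0 dot_eq0 w0.
  have := hc w; rewrite hw dotZl ler_pM2r // => ->; rewrite andbT.
  by rewrite -(pmulr_lge0 _ ww) -dotZl -hw dot_gram dot_ge0.
have c0 : 0 <= c by have /andP[] := eig_le c ceig.
have c_le : Num.sqrt c <= spectral_norm X.
  apply: ub_le_sup; last by exists c.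
  exists (Num.sqrt c) => _ [a /= /eig_le/andP[_ ac] <-].
  by rewrite ler_sqrt.
apply: (@le_trans _ _ (Num.sqrt c * euclidean_norm v)); last first.
  by rewrite ler_wpM2r ?euclidean_norm_ge0.
rewrite -ler_sqr ?nnegrE ?mulr_ge0 ?sqrtr_ge0 ?euclidean_norm_ge0 //.
by rewrite exprMn !euclidean_norm_sqr sqr_sqrtr // -dot_gram.
Qed.

End Spectral.

(** * Perturbing a matrix entrywise *)

Lemma mx_norm_le (R : realType) (m n : nat) (A : 'M[R]_(m, n)) (c : R) :
  0 <= c -> (forall i j, `|A i j| <= c) -> mx_norm A <= c.
Proof. by move=> c0 hA; rewrite mx_normrE bigmax_le // => -[i j] _; exact: hA. Qed.

Lemma le_mx_norm (R : realType) (m n : nat) (A : 'M[R]_(m, n)) i j :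
  `|A i j| <= mx_norm A.
Proof.
by rewrite mx_normrE (le_bigmax _ (fun ij => `|A ij.1 ij.2|) (i, j)).
Qed.

(** In the rank normal form [L (1_s) U] of [Y], put a small [t] in the
    diagonal positions from [s] to [r - 1]. *)
Lemma exists_rank_perturbation (R : realType) (m n r : nat) (Y : 'M[R]_(m, n))
    (delta : R) :
  (\rank Y <= r)%N -> (r <= m)%N -> (r <= n)%N -> 0 < delta ->
  exists2 Z : 'M[R]_(m, n), \rank Z = r & mx_norm (Z - Y) <= delta.
Proof.
move=> rkY rm rn d0.
set s := \rank Y in rkY.
pose E := col_ebase Y *m (pid_mx r - pid_mx s) *m row_ebase Y.
pose t := delta / (1 + mx_norm E).
have E0 : 0 <= mx_norm E by rewrite mx_normE.
have t0 : 0 < t by rewrite divr_gt0 // ltr_pwDl.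
exists (Y + t *: E); last first.
  rewrite addrC addKr; apply: mx_norm_le => [|i j]; first exact: ltW.
  rewrite mxE normrM gtr0_norm // /t mulrAC ler_pdivrMr ?ltr_pwDl //.
  by rewrite ler_pM2l //; have := le_mx_norm E i j; lra.
pose D : 'M[R]_m := diag_mx (\row_i (if (i < s)%N then 1 else t)).
have -> : Y + t *: E = col_ebase Y *m D *m pid_mx r *m row_ebase Y.
  rewrite -{1}(mulmx_ebase Y) -/s /E scalemxAl scalemxAr -mulmxDl -mulmxDr.
  rewrite -!mulmxA; congr (_ *m _); rewrite mulmxA; congr (_ *m _).
  apply/matrixP => i j; rewrite mul_diag_mx !mxE.
  have [is_|is_] := ltnP i s.
    by rewrite (leq_trans is_ rkY) !andbT subrr mulr0 addr0 mul1r.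
  by rewrite !andbF subr0 add0r.
have Dunit : D \in unitmx.
  rewrite unitmxE det_diag unitfE; apply/prodf_neq0 => i _; rewrite mxE.
  by case: ifP; rewrite ?oner_neq0 ?gt_eqF.
rewrite mxrankMfree ?row_free_unit ?row_ebase_unit //.
rewrite -mxrank_tr trmx_mul mxrankMfree.
  by rewrite mxrank_tr rank_pid_mx.
by rewrite row_free_unit unitmx_tr unitmx_mul col_ebase_unit.
Qed.
(** * Coherence bounds and low-rank approximation *)

Lemma normr_dot_le (R : realType) (d : nat) (u v : 'rV[R]_d) :
  `|dot u v| <= euclidean_norm u * euclidean_norm v.
Proof.
rewrite -ler_sqr ?nnegrE ?mulr_ge0 ?euclidean_norm_ge0 //.
by rewrite real_normK ?num_real // exprMn !euclidean_norm_sqr Cauchy_Schwarz.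
Qed.

Lemma dot_row (R : realType) (m n p : nat) (A : 'M[R]_(m, n)) (B : 'M[R]_(n, p))
    i j :
  dot (row i A) (row j B^T) = (A *m B) i j.
Proof.
by rewrite dotE mxE; apply: eq_bigr => l _; rewrite !mxE.
Qed.

Lemma spectral_norm_ge0 (R : realType) (m n : nat) (X : 'M[R]_(m, n)) :
  (0 < n)%N -> 0 <= spectral_norm X.
Proof.
move=> n0; pose e : 'rV[R]_n := delta_mx 0 (Ordinal n0).
have e0 : 0 < euclidean_norm e.
  rewrite lt_def euclidean_norm_ge0 andbT -sqrf_eq0 euclidean_norm_sqr.
  by rewrite /dot trmx_delta mul_delta_mx mxE !eqxx oner_eq0.
rewrite -(pmulr_lge0 _ e0).
exact: le_trans (euclidean_norm_ge0 _) (mulmx_spectral_norm X e).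
Qed.

(** The projection onto the row space can be inserted before [X^T], because
    [X^T] vanishes on its complement; this is what lets the row coherence
    control the columns of [X]. *)
Lemma coherence_row_bound (R : realType) (m n : nat) (X : 'M[R]_(m, n)) i j :
  (0 < \rank X)%N ->
  euclidean_norm (row i (orthogonal_projection X^T)) *
    euclidean_norm (row j X^T)
  <= (\rank X)%:R / Num.sqrt (m%:R * n%:R)
     * Num.sqrt (coherence X^T * coherence X) * spectral_norm X.
Proof.
move=> rk0.
have n0 : (0 < n)%N by apply: leq_trans rk0 (rank_leq_col X).
have -> : row j X^T = row j (orthogonal_projection X) *m X^T.
  by rewrite -row_mul mulmx_orthogonal_projection_tr.
set u := row i _; set v := row j _.
have hu : euclidean_norm u ^+ 2 <= (\rank X)%:R / m%:R * coherence X^T.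
  by rewrite -mxrank_tr orthogonal_projection_coherence // mxrank_tr.
have hv : euclidean_norm v ^+ 2 <= (\rank X)%:R / n%:R * coherence X.
  exact: orthogonal_projection_coherence.
apply: (@le_trans _ _ (euclidean_norm u * euclidean_norm v * spectral_norm X)).
  rewrite -mulrA ler_wpM2l ?euclidean_norm_ge0 // mulrC.
  exact: mulmx_spectral_norm.
rewrite ler_wpM2r ?spectral_norm_ge0 //.
have -> : (\rank X)%:R / Num.sqrt (m%:R * n%:R) * Num.sqrt (coherence X^T * coherence X)
  = Num.sqrt (((\rank X)%:R / m%:R * coherence X^T) * ((\rank X)%:R / n%:R * coherence X)).
  rewrite [in RHS](_ : _ * _ = (\rank X)%:R ^+ 2 * (m%:R * n%:R)^-1
     * (coherence X^T * coherence X)); last by rewrite invfM; ring.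
  have k2 : (0 : R) <= (\rank X)%:R ^+ 2 by rewrite sqr_ge0.
  rewrite [RHS]sqrtrM; last by rewrite mulr_ge0 // invr_ge0 mulr_ge0.
  by rewrite (sqrtrM _ k2) sqrtr_sqr ger0_norm // sqrtrV // mulr_ge0.
rewrite -(ger0_norm (mulr_ge0 (euclidean_norm_ge0 u) (euclidean_norm_ge0 v))).
by rewrite -sqrtr_sqr ler_wsqrtr // exprMn ler_pM ?sqr_ge0.
Qed.

Theorem theorem3p4 (R : realType) :
  exists C : R, 0 < C /\
    forall m n k : nat, (0 < m)%N -> (0 < n)%N -> (0 < k)%N ->
    let k0 : R := C * ln (4 * m%:R * n%:R) in
    (k <= minn m n)%N -> k0 <= k%:R ->
    forall eps : R, Num.sqrt (k0 / k%:R) <= eps -> eps <= 1 ->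
    forall r : nat, (0 < r)%N -> (r <= k)%N -> k0 / eps ^+ 2 <= r%:R ->
    forall X : 'M[R]_(m, n), \rank X = k ->
    exists Y : 'M[R]_(m, n), \rank Y = r /\
      mx_norm (X - Y) <=
        eps * (k%:R / Num.sqrt (m%:R * n%:R))
        * Num.sqrt (coherence X^T * coherence X) * spectral_norm X.
Proof.
have K0 : 0 < proxy :> R by rewrite mulr_gt0 ?expR_gt0 ?exprn_gt0.
(* sketching to accuracy [eps / 2] turns [4 * proxy] into [16 * proxy] *)
exists (16 * proxy); split; first by rewrite mulr_gt0.
move=> m n k m0 n0 kpos k0 kmn _ eps eps_ge eps1 r r0 rk r_ge X rkX.
have mn1 : (1 : R) <= m%:R * n%:R by rewrite -natrM ler1n muln_gt0 m0.
have ln0 : 0 < ln (4 * m%:R * n%:R) :> R by rewrite ln_gt0 // -mulrA; lra.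
have eps0 : 0 < eps.
  apply: lt_le_trans eps_ge; rewrite sqrtr_gt0 divr_gt0 ?ltr0n //.
  by rewrite mulr_gt0 // mulr_gt0.
pose B := k%:R / Num.sqrt (m%:R * n%:R) * Num.sqrt (coherence X^T * coherence X)
          * spectral_norm X.
pose P := orthogonal_projection X^T.
have PX : P *m X = X.
  by have := mulmx_orthogonal_projection_tr X^T; rewrite trmxK.
have row_le i j : euclidean_norm (row i P) * euclidean_norm (row j X^T) <= B.
  by rewrite /B -rkX; apply: coherence_row_bound; rewrite rkX.
(* [B > 0] makes room for the rank perturbation *)
have B0 : 0 < B.
  have /matrix0Pn[i [j Xij]] : X != 0 by rewrite -mxrank_eq0 rkX -lt0n.
  apply: lt_le_trans (row_le i j); apply: lt_le_trans (normr_dot_le _ _).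
  by rewrite dot_row PX normr_gt0.
have [||//||G rkG hG] := @exists_sketch R ('I_m * 'I_n)%type m
    (fun ij => row ij.1 P) (fun ij => row ij.2 X^T) (eps / 2) r.
- by rewrite divr_gt0.
- lra.
- move: r_ge; rewrite ler_pdivrMr ?exprn_gt0 // card_prod !card_ord natrM.
  have : ln (2 * (m%:R * n%:R)) <= ln (4 * m%:R * n%:R) :> R.
    by rewrite ler_ln ?posrE -?[4 * _ * _]mulrA; lra.
  rewrite -(ler_pM2l K0) /k0 expr_div_n; lra.
have [||||Y rkY hY] := @exists_rank_perturbation R m n r (P *m G *m X) (eps / 2 * B).
- by apply: leq_trans (mxrankM_maxl _ _) _; apply: leq_trans (mxrankM_maxr _ _) _.
- by apply: leq_trans rk (leq_trans kmn (geq_minl _ _)).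
- by apply: leq_trans rk (leq_trans kmn (geq_minr _ _)).
- by rewrite mulr_gt0 // divr_gt0.
exists Y; split=> //.
rewrite (_ : _ * spectral_norm X = eps * B); last by rewrite /B !mulrA.
apply: mx_norm_le => [|i j]; first by rewrite mulr_ge0 ?ltW.
have -> : (X - Y) i j = (X i j - (P *m G *m X) i j) - (Y - P *m G *m X) i j.
  by rewrite !mxE; ring.
apply: le_trans (ler_normB _ _) _.
rewrite [eps](splitr eps) mulrDl lerD //; last first.
  exact: le_trans (le_mx_norm _ _ _) hY.
rewrite -{1}PX -!dot_row (row_mul i P G); apply: le_trans (hG (i, j)) _.
by rewrite ler_wpM2l // divr_ge0 // ltW.
Qed.
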